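(* Let $f_1,f_2$ be polynomials on $\mathbb{C}^2$ with $f_2$ not identically zero, and let $\mathcal{Z}=\{v\in B(0,1): f_2(v)=0\}$, where $B(0,1)$ is the unit ball of $\mathbb{C}^2$. Then there exists an atlas of the complex manifold $\mathrm{reg}\,\mathcal{Z}$ with charts defined on $\mathcal{D}(0,1)$ such that for any chart $\phi$ of the atlas and any disk $\mathcal{D}(z_0,R)\subset\mathcal{D}(0,1)$, $$B_{f_1\circ\phi}(1/4;z_0,R)\le C(f_2)\times\deg f_1,$$ where $C(f_2)$ is a constant depending only on $f_2$.
   Context: $\mathcal{D}(z,R)$ denotes the disk in $\mathbb{C}$ with center $z$ and radius $R$. For $f$ analytic on a disk $\mathcal{D}(z_0,R)\subset\mathbb{C}$ and $\mu\in(0,1)$, $M_f(z_0,R)=\sup_{\mathcal{D}(z_0,R)}\log|f|$ and the Bernstein exponent is $B_f(\mu;z_0,R)=M_f(z_0,R)-M_f(z_0,\mu R)$; if $f$ vanishes identically its Bernstein exponents are zero by convention (so the bound is trivially true when $f_1\circ\phi\equiv0$). Regular points: there is a discrete set (relative to $B(0,1)$) of singular points $\mathrm{sng}\,\mathcal{Z}$ such that $\mathrm{reg}\,\mathcal{Z}=\mathcal{Z}\setminus\mathrm{sng}\,\mathcal{Z}$, the set of regular points of $\mathcal{Z}$ (those near which $\mathcal{Z}$ is a one-dimensional complex submanifold), is a one-dimensional complex manifold. A chart is here a biholomorphic parametrization $\phi:\mathcal{D}(0,1)\to\mathrm{reg}\,\mathcal{Z}$ onto an open subset of $\mathrm{reg}\,\mathcal{Z}$;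 an atlas is a family of charts whose images cover $\mathrm{reg}\,\mathcal{Z}$. *)

(* Defs.v *)
(* The notations of [mpoly] clash with those of
   MathComp-Analysis; only its canonical structures and
   coercions are imported. *)
From HB Require Import structures.
From mathcomp Require Export all_boot all_order all_algebra complex.
From mathcomp Require Export all_classical all_reals all_analysis.
From mathcomp Require mpoly.
Export (coercions, canonicals) mpoly.

Set Implicit Arguments.
Unset Strict Implicit.
Unset Printing Implicit Defensive.
Import Order.TTheory GRing.Theory Num.Theory.
Import numFieldNormedType.Exports.
Import ComplexField.Normc.
Local Open Scope classical_set_scope.
Local Open Scope ring_scope.

Definition bipoly (R : realType) := mpoly.mpoly 2 R[i].

Section BernsteinOnCurves.
Variable R : realType.

(* MathComp-Analysis puts the topology of a numerical field on the alias ^o;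
   [normc] is the modulus with values in R, whereas `|z| lives in R[i]. *)
Local Notation C := ((R[i])^o).
Local Notation C2 := (C * C)%type.

Definition disk (z0 : C) (r : R) : set C := [set z | normc (z - z0) < r].

Definition unit_ball2 : set C2 :=
  [set v | normc v.1 ^+ 2 + normc v.2 ^+ 2 < 1].

Definition peval (f : bipoly R) (v : C2) : C :=
  mpoly.meval (fun i : 'I_2 => if i == ord0 then v.1 else v.2) f.

(* Total degree; [msize] is the degree plus one, and the zero polynomial gets
   degree 0. *)
Definition total_degree (f : bipoly R) : nat := (mpoly.msize f).-1.

(* Analytic functions of one and two complex variables: near each point of the
   set, the sum of a convergent power series centred at that point. *)
Definition analytic1 (U : set C) (f : C -> C) : Prop :=
  forall a, U a -> exists c : nat -> C, \forall z \near a,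
    series (fun n => c n * (z - a) ^+ n) @ \oo --> f z.

(* The square partial sums of the moduli converge exactly when the double
   series converges absolutely, and then its sum does not depend on the order
   of summation. *)
Definition analytic2 (U : set C2) (f : C2 -> C) : Prop :=
  forall a, U a -> exists c : nat -> nat -> C, \forall v \near a,
    let term (i j : nat) : C :=
      c i j * (v.1 - a.1) ^+ i * (v.2 - a.2) ^+ j in
    cvgn (fun n => \sum_(i < n) \sum_(j < n) normc (term i j)) /\
    (fun n => \sum_(i < n) \sum_(j < n) term i j) @ \oo --> f v.

Definition analytic_map2 (U : set C2) (F : C2 -> C2) : Prop :=
  analytic2 U (fun v => (F v).1) /\ analytic2 U (fun v => (F v).2).

Definition biholomorphism2 (U V : set C2) (Psi : C2 -> C2) : Prop :=
  analytic_map2 U Psi /\ Psi @` U = V /\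
  exists Phi : C2 -> C2,
    analytic_map2 V Phi /\ forall v, U v -> Phi (Psi v) = v.

(* Z is a one-dimensional complex submanifold near p: local holomorphic
   coordinates of C^2 straighten Z to a coordinate line. *)
Definition submanifold_near (Z : set C2) (p : C2) : Prop :=
  exists (U V : set C2) (Psi : C2 -> C2),
    open U /\ open V /\ U p /\ biholomorphism2 U V Psi /\
    Psi @` (U `&` Z) = V `&` [set w | w.2 = 0].

Definition reg (Z : set C2) : set C2 :=
  [set p | Z p /\ submanifold_near Z p].

(* phi, of which only the restriction to D(0,1) matters, is a biholomorphism
   of D(0,1) onto a relatively open subset of the submanifold S of C^2.
   Holomorphic functions on S are locally restrictions of holomorphic
   functions on open subsets of C^2; the last clause says that the inverse of
   phi is holomorphic in this sense. *)
Definition chart (S : set C2) (phi : C -> C2) : Prop :=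
  let D := disk 0 1 in
  analytic1 D (fun z => (phi z).1) /\ analytic1 D (fun z => (phi z).2) /\
  set_inj D phi /\
  (exists U : set C2, open U /\ phi @` D = S `&` U) /\
  (forall z0, D z0 -> exists (W : set C2) (g : C2 -> C),
      open W /\ W (phi z0) /\ analytic2 W g /\
      forall z, D z -> W (phi z) -> g (phi z) = z).

(* Transition maps between charts of S are automatically holomorphic. *)
Definition atlas (S : set C2) (A : set (C -> C2)) : Prop :=
  (forall phi, A phi -> chart S phi) /\
  S = \bigcup_(phi in A) (phi @` disk 0 1).

Local Open Scope ereal_scope.

(* Extended-real valued: log 0 = -oo, and the supremum may be +oo. *)
Definition log_sup (f : C -> C) (z0 : C) (r : R) : \bar R :=
  ereal_sup [set lne (normc (f z))%:E | z in disk z0 r].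

Definition bernstein (f : C -> C) (mu : R) (z0 : C) (r : R) : \bar R :=
  if `[< forall z, disk z0 r z -> f z = 0%R >] then 0
  else log_sup f z0 r - log_sup f z0 (mu * r)%R.

Definition curve (f : bipoly R) : set C2 :=
  [set v | unit_ball2 v /\ peval f v = 0%R].

End BernsteinOnCurves.

(* Main.v *)
Require Import Defs.
From HB Require Import structures.
From mathcomp Require Import all_boot all_order all_algebra complex.
From mathcomp Require Import all_classical all_reals all_analysis.
From mathcomp Require Import perm ring lra zify.
Set Implicit Arguments.
Unset Strict Implicit.
Unset Printing Implicit Defensive.
Import Order.TTheory GRing.Theory Num.Theory.
Import numFieldNormedType.Exports.
Import ComplexField.Normc.
Local Open Scope classical_set_scope.
Local Open Scope ring_scope.

(** Fix a regular point p of the zero set of f_2 and local coordinates that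
straighten this set near p.  Sliding along the straight line gives power series
x, y with (x(0), y(0)) = p, f_2(x(w), y(w)) = 0 and (x'(0), y'(0)) <> 0.  Put
H(w) = f_1(x(w), y(w)).  Two facts together give the theorem.

The order of contact is bounded.  Either H vanishes near 0, or
H(w) = a w^k + O(w^(k+1)) with a <> 0 and k <= K deg f_1, where K depends
only on f_2 ([exists_contact_bound]).  Say that x'(0) <> 0, and see
f_1, f_2 as polynomials in y with coefficients in C[x].  Up to factors in C[x],
which do not vanish at x(w) for small w <> 0, the polynomial f_2 is a product of
irreducible factors Q ([irreducible_factorization]).  If some Q is flat along
the parametrization and coprime to f_1, the resultant gives
r(x) = U f_1 + V Q with r <> 0 and deg r <= K deg f_1 ([elimination]); since
x - x(0) has a simple zero, r(x(w)) has order at most deg r, and the order of H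
is not larger because V Q is flat ([order_bound_coprime]).  Otherwise every flat
Q divides f_1; the others do not vanish at small w <> 0, hence for such w a flat
one vanishes there, and so does f_1 ([order_bound]).  Summing the bounds over
the finitely many Q makes K independent of f_1 and of p.

A monomial has a bounded Bernstein exponent.  If H ~ a w^k, then on a small
disk |H(w)| lies between two multiples, in the ratio 1 to 3, of |w|^k.  For such
a function the exponent is at most ln 3 + k ln 8 on every disk
([bernstein_monomial_like]), because D(z_0, R/4) has a point of modulus at least
|z_0| + R/8 while D(z_0, R) has none of modulus more than |z_0| + R.

The charts at p are the maps z |-> (x(e z), y(e z)), and e is chosen, for the
given f_1, so small that D(0, e) lies in the disk where H vanishes or is
comparable to w^k.  When deg f_1 = 0 the exponent is 0; otherwise
ln 3 + k ln 8 <= (ln 3 + K ln 8) deg f_1.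

For x, y and H only finite Taylor expansions with error terms are used; they are
stable under sums and products at once, and the algebra above makes up for the
identity theorem. *)

(** * Complex moduli and neighbourhoods *)

Section Modulus.
Variable R : realType.
Local Notation C := ((R[i])^o).
Implicit Types x y z : R[i].

Lemma normc_ge0 z : 0 <= normc z.
Proof. by case: z => a b; exact: sqrtr_ge0. Qed.

Lemma normC_normc z : `|z| = (normc z)%:C%C.
Proof. by rewrite normc_def; case: z. Qed.

Lemma normc_eq0 z : (normc z == 0) = (z == 0).
Proof. by apply/eqP/eqP => [/eq0_normc //|->]; rewrite normc0. Qed.

Lemma normc_gt0 z : (0 < normc z) = (z != 0).
Proof. by rewrite lt_def normc_ge0 andbT normc_eq0. Qed.

Lemma normc_le0 z : normc z <= 0 -> z = 0.
Proof.
by move=> h; apply/eqP; rewrite -normc_eq0 eq_le h normc_ge0.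
Qed.

Lemma normc_opp z : normc (- z) = normc z.
Proof. exact: normcN. Qed.

Lemma normc_add x y : normc (x + y) <= normc x + normc y.
Proof. exact: le_normcD. Qed.

Lemma normc_sub x y : normc (x - y) <= normc x + normc y.
Proof. by rewrite -(normc_opp y) normc_add. Qed.

Lemma normc_dist x y : normc (x - y) = normc (y - x).
Proof. by rewrite -normc_opp opprB. Qed.

Lemma normc_subr x y : normc x - normc y <= normc (x - y).
Proof. by rewrite lerBlDr (le_trans _ (normc_add _ _))// subrK. Qed.

Lemma normc_pow z n : normc (z ^+ n) = normc z ^+ n.
Proof. by elim: n => [|n IH]; rewrite ?expr0 ?normc1// !exprS normcM IH. Qed.

Lemma normc_real (a : R) : normc a%:C%C = `|a|.
Proof. by rewrite /= expr0n /= addr0 sqrtr_sqr. Qed.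

Lemma normc_sum (I : Type) (s : seq I) (P : pred I) (F : I -> R[i]) :
  normc (\sum_(i <- s | P i) F i) <= \sum_(i <- s | P i) normc (F i).
Proof.
elim/big_rec2: _ => [|i u v _ IH]; first by rewrite normc0.
by apply: le_trans (normc_add _ _) _; rewrite lerD2l.
Qed.

Lemma real_pos_complex (e : R[i]) : 0 < e -> exists2 d : R, 0 < d & e = d%:C%C.
Proof.
by case: e => a b; rewrite ltcE /= => /andP[/eqP -> a0]; exists a.
Qed.

(** The balls of R[i] have their radii in R[i], and a positive radius is real. *)
Lemma near_normcP (a : C) (P : C -> Prop) :
  (\forall z \near a, P z) <->
  exists2 d : R, 0 < d & forall z, normc (z - a) < d -> P z.
Proof.
split.
  move=> /nbhs_ballP[e /= e0 he].
  have [d d0 ed] := real_pos_complex e0.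
  exists d => // z hz; apply: he; rewrite /ball /= normC_normc ed ltcR.
  by rewrite normc_dist.
move=> [d d0 hd]; apply/nbhs_ballP; exists d%:C%C => /=; first by rewrite ltcR.
move=> z; rewrite /ball /= normC_normc ltcR normc_dist => hz; exact: hd.
Qed.

Lemma near_normcW (a : C) (P : C -> Prop) :
  (forall z, P z) -> \forall z \near a, P z.
Proof. by move=> hP; apply/near_normcP; exists 1. Qed.

Lemma near_and (a : C) (P Q : C -> Prop) :
  (\forall z \near a, P z) -> (\forall z \near a, Q z) ->
  \forall z \near a, P z /\ Q z.
Proof. by move=> hP hQ; apply: filterS2 hP hQ. Qed.

Lemma near_normc_lt (a : C) (d : R) : 0 < d -> \forall z \near a, normc (z - a) < d.
Proof. by move=> d0; apply/near_normcP; exists d. Qed.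

Lemma near_normc0_lt (d : R) : 0 < d -> \forall z \near (0 : C), normc z < d.
Proof. by move=> d0; apply/near_normcP; exists d => // z; rewrite subr0. Qed.

Lemma near_normc2P (a : C * C) (P : C * C -> Prop) :
  (\forall z \near a, P z) <->
  exists2 d : R, 0 < d & forall v : C * C,
    normc (v.1 - a.1) < d -> normc (v.2 - a.2) < d -> P v.
Proof.
split.
  move=> [[A B] /= [hA hB] hAB].
  have /near_normcP[d d0 hd] := hA.
  have /near_normcP[e e0 he] := hB.
  exists (Num.min d e); first by rewrite lt_min d0.
  move=> v; rewrite !lt_min => /andP[v1 _] /andP[_ v2].
  by apply: hAB; split; [exact: hd | exact: he].
move=> [d d0 hd].
exists ([set z | normc (z - a.1) < d], [set z | normc (z - a.2) < d]) => /=.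
  by split; exact: near_normc_lt.
by move=> v [v1 v2]; exact: hd.
Qed.

Lemma cvg_normcP (u : nat -> C) (l : C) :
  u @ \oo --> l <->
  forall e : R, 0 < e -> \forall n \near \oo, normc (u n - l) < e.
Proof.
rewrite -[u @ _]/(u n @[n --> \oo]) cvgrPdist_lt; split=> h e e0.
  have e0' : 0 < (e%:C)%C :> R[i] by rewrite ltcR.
  move: (h _ e0'); apply: filterS => n; rewrite normC_normc ltcR.
  by rewrite normc_dist.
have [d d0 ->] := real_pos_complex e0.
by move: (h _ d0); apply: filterS => n; rewrite normC_normc ltcR normc_dist.
Qed.

(** Closed balls are closed, so estimates on partial sums pass to the sum. *)
Lemma cvg_normc_le (u : nat -> C) (l b : C) (K : R) :
  u @ \oo --> l -> (\forall n \near \oo, normc (u n - b) <= K) ->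
  normc (l - b) <= K.
Proof.
move=> /cvg_normcP ul hK; apply/ler_addgt0Pr => e e0.
have /filter_ex[n [h1 h2]] : \forall n \near \oo, normc (u n - l) < e /\ normc (u n - b) <= K.
  by apply: filterS2 (ul e e0) hK.
have -> : l - b = (u n - b) - (u n - l) by rewrite opprB [RHS]addrC addrA subrK.
by apply: le_trans (normc_sub _ _) _; rewrite lerD// ltW.
Qed.
End Modulus.

(** * Orders of vanishing at the origin *)

Section Orders.
Variable R : realType.
Local Notation C := ((R[i])^o).
Implicit Types (h g : R[i] -> R[i]) (p : {poly R[i]}).

Definition bigO n h := exists K : R,
  \forall w \near (0 : C), normc (h w) <= K * normc w ^+ n.

Definition bounded_below m h := exists2 c : R, 0 < c &
  \forall w \near (0 : C), c * normc w ^+ m <= normc (h w).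

(** Smoothness at 0 in the weak form of Peano: a polynomial approximation to every
order.  Unlike convergence of power series, it passes to polynomial
expressions without any work on double series. *)
Definition taylor h := forall n, exists p, bigO n (fun w => h w - p.[w]).

Definition leading k (a : R[i]) h := bigO k.+1 (fun w => h w - a * w ^+ k).

Lemma bigO_pos n h : bigO n h -> exists2 K : R, 0 < K &
  \forall w \near (0 : C), normc (h w) <= K * normc w ^+ n.
Proof.
move=> [K hK]; exists (`|K| + 1); first by rewrite ltr_wpDl.
move: hK; apply: filterS => w; move/le_trans; apply.
rewrite ler_wpM2r ?exprn_ge0 ?normc_ge0//.
by apply: le_trans (ler_norm _) _; rewrite lerDl.
Qed.

Lemma bigO_eq_near n h g :
  (\forall w \near (0 : C), h w = g w) -> bigO n h -> bigO n g.
Proof. by move=> hg [K hK]; exists K; apply: filterS2 hg hK => w ->. Qed.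

Lemma bigO_eq n h g : h =1 g -> bigO n h -> bigO n g.
Proof. by move=> hg; apply: bigO_eq_near; apply: near_normcW => w; rewrite hg. Qed.

Lemma bigO_le m n h : (m <= n)%N -> bigO n h -> bigO m h.
Proof.
move=> mn /bigO_pos[K K0 hK]; exists K.
apply: filterS2 hK (near_normc0_lt (@ltr01 R)) => w hw w1.
apply: le_trans hw _; rewrite ler_wpM2l ?(ltW K0)//.
by rewrite ler_wiXn2l ?normc_ge0// ltW.
Qed.

Lemma bigOD n h g : bigO n h -> bigO n g -> bigO n (fun w => h w + g w).
Proof.
move=> [K hK] [L hL]; exists (K + L); apply: filterS2 hK hL => w h1 h2.
by rewrite mulrDl (le_trans (normc_add _ _))// lerD.
Qed.

Lemma bigOM m n h g : bigO m h -> bigO n g -> bigO (m + n) (fun w => h w * g w).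
Proof.
move=> [K hK] [L hL]; exists (K * L); apply: filterS2 hK hL => w h1 h2.
rewrite normcM exprD mulrACA ler_pM ?normc_ge0//.
Qed.

Lemma bigOMl n h g : bigO 0 h -> bigO n g -> bigO n (fun w => h w * g w).
Proof. by move=> h0 hn; have := bigOM h0 hn. Qed.

Lemma bigO_cst (a : R[i]) : bigO 0 (fun=> a).
Proof. by exists (normc a); apply: near_normcW => w; rewrite expr0 mulr1. Qed.

Lemma bigO_zero n : bigO n (fun=> 0).
Proof. by exists 0; apply: near_normcW => w; rewrite normc0 mul0r. Qed.

Lemma bigO_exp n : bigO n (fun w => w ^+ n).
Proof. by exists 1; apply: near_normcW => w; rewrite normc_pow mul1r. Qed.

Lemma bigOZ n (a : R[i]) h : bigO n h -> bigO n (fun w => a * h w).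
Proof. by move=> hh; apply: bigOMl => //; exact: bigO_cst. Qed.

Lemma bigO_poly p : bigO 0 (fun w => p.[w]).
Proof.
elim/poly_ind: p => [|p c IH].
  by apply: bigO_eq (bigO_zero 0) => w; rewrite horner0.
have H : bigO 0 (fun w => p.[w] * w + c).
  apply: bigOD (bigO_cst c).
  by apply: bigO_le (leqnSn 0) _; have := bigOM IH (bigO_exp 1).
by apply: bigO_eq H => w; rewrite hornerMXaddC.
Qed.

(** A function of order at most m is not O(w^(m+1)): compare both bounds at a small
nonzero real w. *)
Lemma bounded_below_bigO m h : bounded_below m h -> ~ bigO m.+1 h.
Proof.
move=> [c c0 hc] /bigO_pos[K K0 hK].
have cK : 0 < c / (2 * K) by rewrite divr_gt0// mulr_gt0.
have /near_normcP[d d0 hd] := near_and hc (near_and hK (near_normc0_lt cK)).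
pose t := d / 2; have t0 : 0 < t by rewrite divr_gt0.
have nt : normc t%:C%C = t by rewrite normc_real gtr0_norm.
have [|] := hd t%:C%C; first by rewrite subr0 nt /t; lra.
rewrite nt => h1 [h2 h3].
have tm : 0 < t ^+ m by rewrite exprn_gt0.
have : c * t ^+ m <= K * t * t ^+ m.
  by rewrite -mulrA -exprS; exact: le_trans h1 h2.
rewrite ler_pM2r// leNgt => /negP; apply.
move: h3; rewrite ltr_pdivlMr ?mulr_gt0// => h3; nra.
Qed.

Lemma leading_below k a h : a != 0 -> leading k a h -> bounded_below k h.
Proof.
rewrite -normc_gt0 => a0 /bigO_pos[K K0 hK].
exists (normc a / 2); first by rewrite divr_gt0.
have aK : 0 < normc a / (2 * K) by rewrite divr_gt0// mulr_gt0.
apply: filterS2 hK (near_normc0_lt aK) => w h1 h2.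
have := normc_subr (a * w ^+ k) (h w); rewrite normc_dist normcM normc_pow.
move: h2; rewrite ltr_pdivlMr ?mulr_gt0// => h2.
have wk : 0 <= normc w ^+ k by rewrite exprn_ge0// normc_ge0.
move: h1; rewrite exprS; set s := normc w ^+ k in wk *; set u := normc (_ - _).
move: a0 h2; set b := normc a; set v := normc w; set y := normc (h w) => a0 h2 h1 h3.
have : K * (v * s) <= b / 2 * s by rewrite mulrA ler_wpM2r//; lra.
nra.
Qed.

Lemma bounded_below_neq0 m h : bounded_below m h ->
  \forall w \near (0 : C), w != 0 -> h w != 0.
Proof.
move=> [c c0 hc]; move: hc; apply: filterS => w hw w0.
rewrite -normc_gt0; apply: lt_le_trans hw.
by rewrite mulr_gt0// exprn_gt0// normc_gt0.
Qed.

(** Divide by the largest power of the variable; the quotient q satisfies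
q(w) = q(0) + O(w) with q(0) nonzero. *)
Lemma poly_leading p : p != 0 ->
  exists k a, [/\ (k < size p)%N, a != 0 & leading k a (fun w => p.[w])].
Proof.
move=> p0; have [k [q]] := multiplicity_XsubC p 0; rewrite p0 /= subr0 => q0 pE.
have qn0 : q != 0 by apply: contraNneq p0 => q00; rewrite pE q00 mul0r.
exists k, q.[0]; split=> //.
  by rewrite pE size_mulXn// -[X in (X < _)%N]addn0 ltn_add2l size_poly_gt0.
have [r rE] : exists r, q = r * 'X + q.[0]%:P.
  have /factor_theorem[r rE] : root (q - q.[0]%:P) 0.
    by rewrite /root !hornerE subrr.
  by exists r; apply/eqP; rewrite -subr_eq rE subr0.
have H := bigOMl (bigO_poly r) (bigO_exp k.+1).
apply: bigO_eq H => w; rewrite pE hornerM hornerXn [in RHS]rE !hornerE exprS.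
ring.
Qed.

Lemma taylor_cst (a : R[i]) : taylor (fun=> a).
Proof.
move=> n; exists a%:P; apply: bigO_eq (bigO_zero n) => w.
by rewrite hornerC subrr.
Qed.

Lemma taylor_bigO0 h : taylor h -> bigO 0 h.
Proof.
move=> /(_ 0%N)[p hp]; apply: bigO_eq (bigOD hp (bigO_poly p)) => w.
by rewrite subrK.
Qed.

Lemma taylorD h g : taylor h -> taylor g -> taylor (fun w => h w + g w).
Proof.
move=> th tg n; have [p hp] := th n; have [q hq] := tg n.
exists (p + q); apply: bigO_eq (bigOD hp hq) => w; rewrite hornerD; ring.
Qed.

Lemma taylorM h g : taylor h -> taylor g -> taylor (fun w => h w * g w).
Proof.
move=> th tg n; have [p hp] := th n; have [q hq] := tg n.
exists (p * q).
apply: bigO_eq (bigOD (bigOMl (bigO_poly q) hp) (bigOMl (taylor_bigO0 th) hq)).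
move=> w; rewrite hornerM; ring.
Qed.

Lemma taylor_horner p h : taylor h -> taylor (fun w => p.[h w]).
Proof.
move=> th; elim/poly_ind: p => [|p c IH].
  by have -> : (fun w => 0.[h w]) = (fun=> 0); [apply/funext => w; rewrite horner0|exact: taylor_cst].
have := taylorD (taylorM IH th) (taylor_cst c).
by under eq_fun do rewrite -hornerMXaddC.
Qed.

Lemma taylor_horner2 (P : {poly {poly R[i]}}) h g : taylor h -> taylor g ->
  taylor (fun w => P.[(g w)%:P].[h w]).
Proof.
move=> th tg; elim/poly_ind: P => [|P p IH].
  by under eq_fun do rewrite !horner0; exact: taylor_cst.
have := taylorD (taylorM IH tg) (taylor_horner p th).
by congr taylor; apply/funext => w; rewrite hornerMXaddC hornerD hornerM hornerC.
Qed.

(** If the approximating polynomial of order n had its lowest term in degree n or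
more, the function itself would be O(w^n). *)
Lemma taylor_leading n h : taylor h -> ~ bigO n h ->
  exists k a, [/\ (k < n)%N, a != 0 & leading k a h].
Proof.
move=> /(_ n)[p hp] nO.
have p0 : p != 0.
  apply/eqP => p0; apply: nO; apply: bigO_eq hp => w.
  by rewrite p0 horner0 subr0.
have [k [a [_ a0 ka]]] := poly_leading p0.
have [nk|kn] := leqP n k.
  exfalso; apply: nO.
  have H := bigOD (bigOD hp (bigO_le (leqW nk) ka)) (bigOZ a (bigO_le nk (bigO_exp k))).
  apply: bigO_eq H => w; ring.
exists k, a; split=> //.
apply: bigO_eq (bigOD (bigO_le kn hp) ka) => w; ring.
Qed.

(** From h = u g + O(w^(m+1)) with u bounded, the lower bound on h passes to g.  In
the elimination below h is the resultant, and the error is the term that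
contains the flat factor. *)
Lemma bounded_belowMl m h g u : bigO 0 u -> bounded_below m h ->
   bigO m.+1 (fun w => h w - u w * g w) -> bounded_below m g.
Proof.
move=> /bigO_pos[M M0 hM] [c c0 hc] /bigO_pos[K K0 hK].
exists (c / (2 * M)); first by rewrite divr_gt0// mulr_gt0.
have cK : 0 < c / (2 * K) by rewrite divr_gt0// mulr_gt0.
have H := near_and (near_and hM hc) (near_and hK (near_normc0_lt cK)).
move: H; apply: filterS => w [[]].
rewrite expr0 mulr1 exprS => h1 h2 [h3 h4].
have := normc_subr (h w) (u w * g w); rewrite normcM => h5.
have wm : 0 <= normc w ^+ m by rewrite exprn_ge0// normc_ge0.
have h6 : K * (normc w * normc w ^+ m) <= c / 2 * normc w ^+ m.
  by move: h4; rewrite ltr_pdivlMr ?mulr_gt0// => h4; rewrite mulrA ler_wpM2r//; lra.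
have h7 : normc (u w) * normc (g w) <= M * normc (g w).
  by rewrite ler_wpM2r// normc_ge0.
rewrite [c / _ * _]mulrAC ler_pdivrMr ?mulr_gt0//; lra.
Qed.

End Orders.

(** * Factorization and elimination over a ring of polynomials *)

Section Elimination.

(** Over an integral domain [%=] and irreducibility only see the polynomials up to
nonzero constants of the domain, so that this is factorization over the field
of fractions with cleared denominators. *)
Lemma irreducible_factorization (D : idomainType) (p : {poly D}) : p != 0 ->
  exists2 s : seq {poly D},
    (forall q, q \in s -> irreducible_poly q) & p %= \prod_(q <- s) q.
Proof.
have [n] := ubnP (size p); elim: n p => // n IH p; rewrite ltnS => sp p0.
have [sp1|sp1] := leqP (size p) 1.
  exists [::] => //; rewrite big_nil.
  by rewrite -size_poly_eq1 eqn_leq sp1 size_poly_gt0.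
have [irr|] := EM (irreducible_poly p).
  exists [:: p]; last by rewrite big_seq1 eqpxx.
  by move=> q; rewrite inE => /eqP ->.
move=> nirr.
have [q [q1 qp nqp]] : exists q : {poly D}, [/\ size q != 1, q %| p & ~~ (q %= p)].
  apply: contrapT => h; apply: nirr; split=> // q q1 qp.
  by apply: contrapT => /negP nqp; apply: h; exists q.
have /Pdiv.Idomain.dvdpP[[c r] /= c0 cpE] := qp.
have cp0 : c *: p != 0 by rewrite -size_poly_eq0 size_scale// size_poly_eq0.
have : q != 0 /\ r != 0.
  by move: cp0; rewrite cpE mulf_eq0 negb_or => /andP[-> ->].
move=> [q0 r0].
have szq : (size q < size p)%N.
  rewrite ltn_neqAle dvdp_leq// andbT; apply: contra nqp => /eqP sqp.
  by rewrite -dvdp_size_eqp// sqp.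
have szr : (size r < size p)%N.
  rewrite -(size_scale p c0) cpE size_mul//.
  have : (0 < size q)%N /\ (0 < size r)%N by rewrite !size_poly_gt0.
  by move: q1; lia.
have [s1 h1 e1] := IH q (leq_trans szq sp) q0.
have [s2 h2 e2] := IH r (leq_trans szr sp) r0.
exists (s1 ++ s2).
  by move=> t; rewrite mem_cat => /orP[]; [exact: h1|exact: h2].
rewrite big_cat /=; apply: (@eqp_trans _ (c *: p)); first by rewrite eqp_sym eqp_scale.
rewrite cpE mulrC; apply: (@eqp_trans _ (q * \prod_(t <- s2) t)).
  by rewrite eqp_mull.
exact: eqp_mulr.
Qed.

Lemma irreducible_coprime (D : idomainType) (p q : {poly D}) :
  irreducible_poly q -> ~~ (q %| p) -> coprimep p q.
Proof.
move=> irr; apply: contraR; rewrite coprimep_def => g1.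
have /irr : gcdp p q %| q by exact: dvdp_gcdr.
by move=> /(_ g1) /eqp_dvdl <-; exact: dvdp_gcdl.
Qed.

Variable K : fieldType.
Implicit Types P Q : {poly {poly K}}.

Lemma size_det_leq n (A : 'M[{poly K}]_n) (d : 'I_n -> nat) :
  (forall i j, size (A i j) <= (d i).+1)%N ->
  (size (\det A) <= (\sum_i d i).+1)%N.
Proof.
move=> hA; rewrite /determinant (leq_trans (size_sum _ _ _))//.
apply/bigmax_leqP => s _.
rewrite mulr_sign (fun_if (fun p : {poly K} => size p)) size_polyN if_same.
apply: leq_trans (size_poly_prod_leq _ _) _.
have : (\sum_(i < n) size (A i (s i)) <= \sum_(i < n) (d i).+1)%N.
  by apply: leq_sum => i _; exact: hA.
under [X in (_ <= X)%N -> _]eq_bigr do rewrite -addn1.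
rewrite big_split /= sum1_card => h; by rewrite leq_subLR addnS ltnS [leqRHS]addnC.
Qed.

Definition xdegree_le P D := forall j, (size (P`_j)%R <= D.+1)%N.

(** The Sylvester matrix has deg Q rows of coefficients of P and deg P rows of
coefficients of Q. *)
Lemma size_resultant_leq P Q D E : xdegree_le P D -> xdegree_le Q E ->
  (size (resultant P Q) <= (D * (size Q).-1 + E * (size P).-1).+1)%N.
Proof.
move=> hP hQ; rewrite /resultant.
pose d (i : 'I_((size Q).-1 + (size P).-1)) :=
  match fintype.split i with inl _ => D | inr _ => E end.
apply: leq_trans (@size_det_leq _ _ d _) _; last first.
  rewrite big_split_ord /= ltnS /d.
  under eq_bigr => i _ do rewrite (unsplitK (inl i)).
  under [X in (_ + X <= _)%N]eq_bigr => i _ do rewrite (unsplitK (inr i)).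
  by rewrite !sum_nat_const !card_ord; lia.
move=> i j; rewrite Sylvester_mxE /d.
case: (fintype.split i) => k; case: (k <= j)%N; by rewrite ?mulr1n ?mulr0n ?size_poly0.
Qed.

(** The identity is the one of the resultant, except when P is constant in y: then
P itself has been eliminated. *)
Lemma elimination P Q D E : P != 0 -> coprimep P Q -> (1 < size Q)%N ->
  xdegree_le P D -> xdegree_le Q E ->
  exists r U V, [/\ r != 0, r%:P = U * P + V * Q &
    (size r <= (D * (size Q).-1 + E * (size P).-1).+1)%N].
Proof.
move=> P0 cop sQ hP hQ.
have [sP|sP] := leqP (size P) 1.
  have PE := size1_polyC sP.
  exists P`_0, 1, 0; split.
  - by apply: contraNneq P0 => c0; rewrite PE c0 polyC0.
  - by rewrite mul1r mul0r addr0.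
  - by apply: leq_trans (hP 0%N) _; rewrite ltnS; nia.
have [[U V] /= _ eUV] := resultant_in_ideal sP sQ.
exists (resultant P Q), U, V; split=> //; last exact: size_resultant_leq.
by rewrite resultant_eq0 -leqNgt; rewrite coprimep_def in cop; rewrite (eqP cop).
Qed.

End Elimination.

(** * Order of contact of two plane curves along a parametrization *)

Section OrderOnCurve.
Variable R : realType.
Local Notation C := ((R[i])^o).
Implicit Types (P Q : {poly {poly R[i]}}) (x y h t : R[i] -> R[i]).

Definition ev2 P x y : R[i] -> R[i] := fun w => P.[(y w)%:P].[x w].

Lemma ev2M P Q x y w : ev2 (P * Q) x y w = ev2 P x y w * ev2 Q x y w.
Proof. by rewrite /ev2 !hornerM. Qed.

Lemma ev2D P Q x y w : ev2 (P + Q) x y w = ev2 P x y w + ev2 Q x y w.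
Proof. by rewrite /ev2 !hornerD. Qed.

Lemma ev2C r x y w : ev2 r%:P x y w = r.[x w].
Proof. by rewrite /ev2 hornerC. Qed.

Lemma ev2Z r P x y w : ev2 (r *: P) x y w = r.[x w] * ev2 P x y w.
Proof. by rewrite -mul_polyC ev2M ev2C. Qed.

Lemma bounded_below_comp k h t : bounded_below k h -> bigO 1 t ->
  bounded_below 1 t -> bounded_below k (fun w => h (t w)).
Proof.
move=> [c c0 /near_normcP[d d0 hc]] /bigO_pos[K K0 hK] [b b0 hb].
exists (c * b ^+ k); first by rewrite mulr_gt0 ?exprn_gt0.
have dK : 0 < d / K by rewrite divr_gt0.
have H := near_and hb (near_and hK (near_normc0_lt dK)).
move: H; apply: filterS => w [h1 [h2 h3]].
have tw : normc (t w - 0) < d.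
  by rewrite subr0 (le_lt_trans h2)// expr1 mulrC -ltr_pdivlMr.
apply: le_trans (hc _ tw); rewrite -mulrA ler_wpM2l ?(ltW c0)//.
rewrite -exprMn; apply: lerXn2r; rewrite ?nnegrE ?normc_ge0//.
by rewrite mulr_ge0 ?normc_ge0// ltW.
Qed.

(** Where x - x0 has a simple zero, r(x) vanishes to the order of r at x0, which is
at most its degree. *)
Lemma poly_below (r : {poly R[i]}) x (x0 : R[i]) : r != 0 ->
  bigO 1 (fun w => x w - x0) -> bounded_below 1 (fun w => x w - x0) ->
  exists2 m, (m < size r)%N & bounded_below m (fun w => r.[x w]).
Proof.
move=> r0 hO hB; pose s := r \Po ('X + x0%:P).
have ss : size s = size r by rewrite size_comp_poly2// size_XaddC.
have s0 : s != 0 by rewrite -size_poly_eq0 ss size_poly_eq0.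
have [k [a [ks a0 ka]]] := poly_leading s0.
exists k; first by rewrite -ss.
have := bounded_below_comp (leading_below a0 ka) hO hB.
congr bounded_below; apply/funext => w.
by rewrite horner_comp !hornerE subrK.
Qed.

(** Continuity at the origin, extracted from the expansion to order 1. *)
Lemma taylor_eq0 h : taylor h ->
  (\forall w \near (0 : C), w != 0 -> h w = 0) ->
  \forall w \near (0 : C), h w = 0.
Proof.
move=> th h0; suff H : h 0 = 0.
  by move: h0; apply: filterS => w hw; have [->//|/hw] := eqVneq w 0.
have [|nO] := EM (bigO 1 h).
  move=> [K /near_normcP[d d0 /(_ 0)]]; rewrite subr0 normc0 expr1 mulr0.
  by move=> /(_ d0)/normc_le0.
have [k [a [_ a0 /(leading_below a0)/bounded_below_neq0 hk]]] := taylor_leading th nO.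
have /near_normcP[d d0 hd] := near_and h0 hk.
pose w : R[i] := (d / 2)%:C%C.
have nw : normc w = d / 2 by rewrite normc_real gtr0_norm// divr_gt0.
have w0 : w != 0 by rewrite -normc_gt0 nw divr_gt0.
have [|h1 h2] := hd w; first by rewrite subr0 nw; lra.
by move: (h2 w0); rewrite (h1 w0) eqxx.
Qed.

(** One more than the degree in x.  Only its finiteness matters: it enters the
final constant. *)
Definition xdegree P := \max_(i < size P) size (P`_i)%R.

Lemma xdegree_leP P : xdegree_le P (xdegree P).
Proof.
move=> j; have [jP|Pj] := ltnP j (size P); last by rewrite nth_default// size_poly0.
by apply: leqW; apply: (leq_bigmax (Ordinal jP)).
Qed.

(** In r(x) = U P + V Q the term V Q is flat, so the order of P along the curve is
at most that of r(x), hence at most deg r.  The degree of r is linear in D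
because each product in the Sylvester determinant has deg Q factors from P and
deg P factors from Q. *)
Lemma order_bound_coprime P Q D x y (x0 : R[i]) :
  taylor x -> taylor y ->
  bigO 1 (fun w => x w - x0) -> bounded_below 1 (fun w => x w - x0) ->
  P != 0 -> (1 < size Q)%N -> coprimep P Q ->
  (size P <= D.+1)%N -> xdegree_le P D ->
  (forall n, bigO n (ev2 Q x y)) ->
  exists k a, [/\ (k <= ((size Q).-1 + xdegree Q) * D)%N, a != 0 &
    leading k a (ev2 P x y)].
Proof.
move=> tx ty xO xB P0 sQ cop sP hP flatQ.
have [r [U [V [r0 rE rs]]]] := elimination P0 cop sQ hP (@xdegree_leP Q).
have [m mr hm] := poly_below r0 xO xB.
have hU : bigO 0 (ev2 U x y) by apply/taylor_bigO0/taylor_horner2.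
have hV : bigO 0 (ev2 V x y) by apply/taylor_bigO0/taylor_horner2.
have hB : bounded_below m (ev2 P x y).
  apply: bounded_belowMl hU hm _.
  apply: bigO_eq (bigOMl hV (flatQ m.+1)) => w.
  by rewrite -(ev2C r x y) rE ev2D !ev2M addrC addKr.
have tP : taylor (ev2 P x y) by exact: taylor_horner2.
have [k [a [km a0 ka]]] := taylor_leading tP (bounded_below_bigO hB).
exists k, a; split=> //.
have : (m <= D * (size Q).-1 + xdegree Q * (size P).-1)%N.
  by rewrite -ltnS; exact: leq_trans mr rs.
move: km sP; rewrite ltnS; move: (xdegree Q) (size Q) (size P) => e q p.
nia.
Qed.

(** P2 is, up to factors in x alone, a product of irreducible Q.  A flat Q coprime
to P1 bounds the order.  If there is none, then for each small w <> 0 some Q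
vanishes at the point of parameter w; it cannot be a nonflat one, and a flat one
divides P1. *)
Lemma order_bound P2 : P2 != 0 -> exists K : nat,
  forall P1 D x y (x0 : R[i]), taylor x -> taylor y ->
  bigO 1 (fun w => x w - x0) -> bounded_below 1 (fun w => x w - x0) ->
  (\forall w \near (0 : C), ev2 P2 x y w = 0) ->
  (size P1 <= D.+1)%N -> xdegree_le P1 D ->
  (\forall w \near (0 : C), ev2 P1 x y w = 0) \/
  exists k a, [/\ (k <= K * D)%N, a != 0 & leading k a (ev2 P1 x y)].
Proof.
move=> P20; have [s sirr /Pdiv.CommonIdomain.eqpP[[c e] /= /andP[c0 e0] ce]] :=
  irreducible_factorization P20.
exists (\sum_(Q <- s) ((size Q).-1 + xdegree Q))%N => P1 D x y x0 tx ty xO xB Z2 sP1 hP1.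
have [P10|P10] := eqVneq P1 0.
  by left; apply: near_normcW => w; rewrite P10 /ev2 !horner0.
have [[Q [Qs ndvd flatQ]]|hs] :=
    EM (exists Q, [/\ Q \in s, ~~ (Q %| P1) & forall n, bigO n (ev2 Q x y)]).
  right; have irrQ := sirr _ Qs.
  have [k [a [kK a0 ka]]] := order_bound_coprime tx ty xO xB P10 irrQ.1
    (irreducible_coprime irrQ ndvd) sP1 hP1 flatQ.
  exists k, a; split=> //; apply: leq_trans kK _; rewrite leq_mul2r.
  by rewrite (big_rem Q)//= leq_addr orbT.
left; apply: taylor_eq0; first exact: taylor_horner2.
have {hs}hs Q : Q \in s -> \forall w \near (0 : C), w != 0 ->
    ev2 Q x y w = 0 -> ev2 P1 x y w = 0.
  move=> Qs; have [flatQ|] := EM (forall n, bigO n (ev2 Q x y)); last first.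
    move=> /existsNP[n nO].
    have [k [a [_ a0 /(leading_below a0)/bounded_below_neq0]]] :=
      taylor_leading (h := ev2 Q x y) (taylor_horner2 Q tx ty) nO.
    by apply: filterS => w hw w0 Q0; move: (hw w0); rewrite Q0 eqxx.
  have /Pdiv.Idomain.dvdpP[[d T] /= d0 dE] : Q %| P1.
    by apply: contrapT => /negP nd; apply: hs; exists Q.
  have [m _ /bounded_below_neq0] := poly_below d0 xO xB.
  apply: filterS => w hw w0 Q0; apply: (mulfI (hw w0)).
  by rewrite mulr0 -ev2Z dE ev2M Q0 mulr0.
have [m _ /bounded_below_neq0 he] := poly_below e0 xO xB.
have {hs}hs : \forall w \near (0 : C), w != 0 ->
    ev2 (\prod_(Q <- s) Q) x y w = 0 -> ev2 P1 x y w = 0.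
  elim: s hs {sirr ce} => [|Q s IH] hs.
    apply: near_normcW => w _; rewrite big_nil /ev2 !hornerC => /eqP.
    by rewrite oner_eq0.
  have h1 := hs Q (mem_head _ _).
  have h2 := IH (fun Q' Q's => hs Q' (mem_behead (s := Q :: s) Q's)).
  apply: filterS2 h1 h2 => w h1 h2 w0.
  by rewrite big_cons ev2M => /eqP; rewrite mulf_eq0 => /orP[]/eqP; [exact: h1|exact: h2].
move: (near_and hs (near_and Z2 he)); apply: filterS => w [h1 [h2 h3]] w0.
apply: h1 => //; apply: (mulfI (h3 w0)).
by rewrite mulr0 -ev2Z -ce ev2Z h2 mulr0.
Qed.

End OrderOnCurve.

(** * Analytic functions: expansions, continuity, slices *)

Section PowerSeries.
Variable R : realType.
Local Notation C := ((R[i])^o).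
Local Notation C2 := (C * C)%type.

Lemma geometric_tail (t : R) m k : 0 <= t -> t <= 2^-1 ->
  \sum_(m <= i < m + k) t ^+ i <= 2 * t ^+ m.
Proof.
move=> t0 t2; suff : \sum_(m <= i < m + k) t ^+ i <= 2 * (t ^+ m - t ^+ (m + k)).
  move/le_trans; apply; rewrite ler_pM2l// gerBl; exact: exprn_ge0.
elim: k => [|k IH]; first by rewrite addn0 big_geq// subrr mulr0.
rewrite addnS big_nat_recr ?leq_addr//= exprS.
have : 0 <= t ^+ (m + k) by exact: exprn_ge0.
move: IH; nra.
Qed.

(** Convergence at one point rho bounds c_i rho^i for large i; the tail of the
series at |w| <= rho / 2 is then dominated by a geometric one. *)
Lemma series_taylor (c : nat -> C) (h : R[i] -> R[i]) :
  (\forall w \near (0 : C), series (fun n => c n * w ^+ n) @ \oo --> (h w : C)) ->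
  taylor h.
Proof.
move=> /near_normcP[d d0 hd] n.
have [rho rho0 rhod] : exists2 rho : R, 0 < rho & rho < d.
  by exists (d / 2); lra.
have nrho : normc rho%:C%C = rho by rewrite normc_real gtr0_norm.
have [|N _ hN] := (cvg_normcP _ _).1 (hd rho%:C%C _) _ (@ltr01 R).
  by rewrite subr0 nrho.
have cbound i : (N <= i)%N -> normc (c i) * rho ^+ i <= 2.
  move=> Ni; have h1 := hN _ (leqW Ni); have h2 := hN _ Ni.
  move: h1 h2 => /=; rewrite seriesSr; set S := series _ i; set l := h _.
  move=> h1 h2; rewrite -nrho -normc_pow -normcM.
  have -> : c i * rho%:C%C ^+ i = (S + c i * rho%:C%C ^+ i - l) - (S - l).
    by rewrite opprB addrA subrK addrAC subrr add0r.
  by apply: le_trans (normc_sub _ _) _; lra.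
(* the bound on the coefficients only holds from N on *)
pose m := maxn n N.
exists (\poly_(i < m) c i); apply: (@bigO_le _ n m); first exact: leq_maxl.
exists (4 / rho ^+ m); apply/near_normcP; exists (rho / 2); first by rewrite divr_gt0.
move=> w; rewrite subr0 => wr.
have wd : normc (w - 0) < d by rewrite subr0 (lt_trans wr)//; lra.
have t2 : normc w / rho <= 2^-1 by rewrite ler_pdivrMr//; lra.
have t0 : 0 <= normc w / rho by rewrite divr_ge0 ?normc_ge0// ltW.
apply: cvg_normc_le (hd w wd) _.
exists m => // k /= mk; rewrite horner_poly.
rewrite /series /= (big_cat_nat (leq0n m) mk) /= big_mkord addrAC subrr add0r.
apply: le_trans (normc_sum _ _ _) _.
have -> : 4 / rho ^+ m * normc w ^+ m = 2 * (2 * (normc w / rho) ^+ m).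
  by rewrite exprMn exprVn; ring.
rewrite -(subnKC mk); apply: le_trans (ler_wpM2l _ (geometric_tail m (k - m) t0 t2)) => //.
rewrite mulr_sumr; apply: ler_sum_nat => i /andP[mi _].
rewrite normcM normc_pow exprMn exprVn [leRHS]mulrA [leRHS]mulrAC ler_wpM2r//.
  by rewrite exprn_ge0 ?normc_ge0.
by rewrite ler_pdivlMr ?exprn_gt0//; apply: cbound; apply: leq_trans mi; exact: leq_maxr.
Qed.

(** Adds a constant to the square partial sums of a double series by changing its
constant coefficient alone; the empty sum has to be left out. *)
Lemma double_sum_delta (V : zmodType) (F : nat -> nat -> V) (k : V) n :
  \sum_(i < n.+1) \sum_(j < n.+1) (F i j + k *+ ((i == 0 :> nat) && (j == 0 :> nat)))
  = \sum_(i < n.+1) \sum_(j < n.+1) F i j + k.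
Proof.
under eq_bigr => i _ do rewrite big_split.
rewrite big_split /=; congr (_ + _).
rewrite big_ord_recl [X in _ + X]big1 ?addr0; last first.
  by move=> i _; rewrite big1.
by rewrite big_ord_recl [X in _ + X]big1 ?addr0.
Qed.

(** Here b is the constant coefficient.  The sum of |c_ij| e^(i+j) is finite for
some e > 0; replacing e by t <= e multiplies each term other than the constant
one by at most t / e. *)
Lemma analytic2_center (U : set C2) (f : C2 -> C) (a : C2) :
  analytic2 U f -> U a -> exists (b : C) (L : R), 0 < L /\
  exists2 d : R, 0 < d & forall (v : C2) (t : R), t <= d ->
    normc (v.1 - a.1) <= t -> normc (v.2 - a.2) <= t ->
    normc (f v - b) <= L * t.
Proof.
move=> hf Ua; have [c /near_normc2P[d d0 hd]] := hf a Ua.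
pose e := d / 2; have e0 : 0 < e by rewrite divr_gt0.
have ne : normc (e%:C%C : R[i]) = e by rewrite normc_real gtr0_norm.
pose v0 : C2 := (a.1 + e%:C%C, a.2 + e%:C%C).
have v01 : normc (v0.1 - a.1) = e by rewrite /= addrAC subrr add0r ne.
have v02 : normc (v0.2 - a.2) = e by rewrite /= addrAC subrr add0r ne.
have ed : e < d by rewrite /e; lra.
have [||/cvg_ex[l hl] _] := hd v0; rewrite ?v01 ?v02//.
have [N _ hN] := (cvgrPdist_lt _ _).1 hl 1 ltr01.
exists (c 0%N 0%N), ((`|l| + 1) / e); split.
  by rewrite divr_gt0// ltr_wpDl.
exists e => // v t te v1 v2; have t0 : 0 <= t := le_trans (normc_ge0 _) v1.
have [||_ hv] := hd v; [exact: le_lt_trans v1 (le_lt_trans te ed)|exact: le_lt_trans v2 (le_lt_trans te ed)|].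
apply: cvg_normc_le hv _; exists N.+1 => // -[//|n] /= Nn.
have /= := hN n.+1 (leqW Nn); set Q := \sum_(i < _) _ => hQ.
have {hQ} : Q <= `|l| + 1.
  have := ler_norm (- (l - Q)); have := ler_norm l; rewrite normrN opprB; lra.
move=> hQ.
pose F i j := c i j * (v.1 - a.1) ^+ i * (v.2 - a.2) ^+ j.
rewrite -(double_sum_delta F (- c 0%N 0%N)).
apply: (@le_trans _ _ (t / e * Q)); last first.
  have -> : (`|l| + 1) / e * t = t / e * (`|l| + 1) by ring.
  by rewrite ler_wpM2l// divr_ge0// ltW.
rewrite /Q mulr_sumr; apply: le_trans (normc_sum _ _ _) (ler_sum _ _) => i _.
rewrite mulr_sumr; apply: le_trans (normc_sum _ _ _) (ler_sum _ _) => j _.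
have [/andP[/eqP i0 /eqP j0]|ij0] := boolP ((i == 0 :> nat) && (j == 0 :> nat)).
  rewrite /F i0 j0 !expr0 !mulr1 subrr normc0.
  by rewrite mulr_ge0 ?normc_ge0// divr_ge0// ltW.
rewrite mulr0n addr0 /F !normcM !normc_pow v01 v02 -[X in _ <= _ * X]mulrA -exprD.
case E : (i + j)%N => [|s]; first by move: E ij0 => /eqP; rewrite addn_eq0 => ->.
rewrite mulrCA -mulrA ler_wpM2l ?normc_ge0//.
apply: (@le_trans _ _ (t ^+ (i + j))).
  by rewrite exprD ler_pM ?exprn_ge0 ?normc_ge0// lerXn2r// nnegrE normc_ge0.
rewrite E !exprS mulrA divfK ?gt_eqF// ler_wpM2l// lerXn2r// nnegrE//.
exact: ltW.
Qed.

Lemma analytic2_lipschitz (U : set C2) (f : C2 -> C) (a : C2) :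
  analytic2 U f -> U a -> exists2 L : R, 0 < L &
  exists2 d : R, 0 < d & forall (v : C2) (t : R), t <= d ->
    normc (v.1 - a.1) <= t -> normc (v.2 - a.2) <= t ->
    normc (f v - f a) <= L * t.
Proof.
move=> hf Ua; have [b [L [L0 [d d0 H]]]] := analytic2_center hf Ua.
have fab : f a = b.
  apply/eqP; rewrite -subr_eq0 -normc_eq0 eq_le normc_ge0 andbT.
  by rewrite -(mulr0 L); apply: H (ltW d0) _ _; rewrite subrr normc0.
by exists L => //; exists d => //; rewrite fab.
Qed.

Lemma analytic2_near (U : set C2) (f : C2 -> C) (a : C2) (e : R) :
  analytic2 U f -> U a -> 0 < e ->
  \forall v \near a, normc (f v - f a) < e.
Proof.
move=> hf Ua e0; have [L L0 [d d0 H]] := analytic2_lipschitz hf Ua.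
have eL : 0 < e / (2 * L) by rewrite divr_gt0// mulr_gt0.
apply/near_normc2P; exists (Num.min d (e / (2 * L))).
  by rewrite lt_min d0.
move=> v v1 v2; have md : Num.min d (e / (2 * L)) <= d by rewrite ge_min lexx.
apply: le_lt_trans (H v _ md (ltW v1) (ltW v2)) _.
apply: (@le_lt_trans _ _ (L * (e / (2 * L)))).
  by rewrite ler_wpM2l ?(ltW L0)// ge_min lexx orbT.
have -> : L * (e / (2 * L)) = e / 2 by field; rewrite gt_eqF.
lra.
Qed.

Lemma cvg_eqfun (T : topologicalType) (u v : nat -> T) (l : T) :
  u =1 v -> u @ \oo --> l -> v @ \oo --> l.
Proof. by move=> /funext ->. Qed.

(** On the line v.2 = a.2 only the terms with j = 0 remain. *)
Lemma analytic2_slice (U : set C2) (f : C2 -> C) (a : C2) :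
  analytic2 U f -> U a -> exists c : nat -> C,
  \forall w \near (0 : C),
    series (fun n => c n * w ^+ n) @ \oo --> f (a.1 + w, a.2).
Proof.
move=> hf Ua; have [c /near_normc2P[d d0 hd]] := hf a Ua.
exists (fun n => c n 0%N); apply/near_normcP; exists d => // w.
rewrite subr0 => wd; have [||_] := hd (a.1 + w, a.2).
- by rewrite /= addrAC subrr add0r.
- by rewrite /= subrr normc0.
rewrite /= subrr addrAC subrr add0r; apply: cvg_eqfun => -[|n].
  by rewrite big_ord0 /series /= big_geq.
rewrite /series /= big_mkord; apply: eq_bigr => i _.
rewrite big_ord_recl big1 ?addr0 ?mulr1// => j _.
by rewrite expr0n /= mulr0.
Qed.

Lemma analytic2_slice_analytic1 (U : set C2) (f : C2 -> C) (D : set C) (b s y : C) :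
  analytic2 U f -> (forall z, D z -> U (b + s * z, y)) ->
  analytic1 D (fun z => f (b + s * z, y)).
Proof.
move=> hf hU a Da; have [c /near_normcP[d d0 hd]] := analytic2_slice hf (hU _ Da).
exists (fun n => c n * s ^+ n); apply/near_normcP.
exists (d / (normc s + 1)); first by rewrite divr_gt0// ltr_wpDl ?normc_ge0.
move=> z zd; have zs : normc (s * (z - a) - 0) < d.
  rewrite subr0 normcM; move: zd; rewrite ltr_pdivlMr ?ltr_wpDl ?normc_ge0// => zd.
  by apply: le_lt_trans zd; have := normc_ge0 (z - a); nra.
have := hd _ zs => /=.
have -> : b + s * a + s * (z - a) = b + s * z by ring.
apply: cvg_eqfun => n; congr (series _ n); apply/funext => k.
by rewrite exprMn mulrA.
Qed.

Lemma analytic2_affine (U : set C2) (f : C2 -> C) (k b : C) :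
  analytic2 U f -> analytic2 U (fun v => k * (f v + b)).
Proof.
move=> hf a Ua; have [c hc] := hf a Ua.
exists (fun i j => k * (c i j + b *+ ((i == 0) && (j == 0)))).
move: hc; apply: filterS => v /= [h1 h2]; split.
  have /cvg_ex[/= l hl] := h1.
  pose r : R := normc (c 0%N 0%N + b) - normc (c 0%N 0%N).
  apply/cvg_ex; exists ((normc k : R) * (l + r)).
  apply/cvgrPdist_lt => e e0.
  have ek : 0 < e / (normc k + 1) by rewrite divr_gt0// ltr_wpDl ?normc_ge0.
  have [N _ hN] := (cvgrPdist_lt _ _).1 hl _ ek.
  exists N.+1 => // -[//|n] /= Nn; have := hN n.+1 (leqW Nn) => /=.
  set S := \sum_(i < n.+1) _ => hS; set T := \sum_(i < n.+1) _.
  have -> : T = normc k * (S + r).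
    pose F i j := normc (c i j * (v.1 - a.1) ^+ i * (v.2 - a.2) ^+ j).
    rewrite /T /S -(double_sum_delta F) mulr_sumr; apply: eq_bigr => i _.
    rewrite mulr_sumr; apply: eq_bigr => j _; rewrite /F !normcM !normc_pow.
    have [/andP[/eqP -> /eqP ->]|_] := boolP ((i == 0 :> nat) && (j == 0 :> nat)).
      by rewrite !expr0 !mulr1 !mulr1n /r; ring.
    by rewrite mulr0n !addr0 !mulrA.
  have -> : normc k * (l + r) - normc k * (S + r) = normc k * (l - S) by ring.
  rewrite normrM (ger0_norm (normc_ge0 _)).
  move: hS; rewrite ltr_pdivlMr ?ltr_wpDl ?normc_ge0// => hS.
  by apply: le_lt_trans hS; have := normr_ge0 (l - S); nra.
apply/cvg_normcP => e e0.
have ek : 0 < e / (normc k + 1) by rewrite divr_gt0// ltr_wpDl ?normc_ge0.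
have [N _ hN] := (cvg_normcP _ _).1 h2 _ ek.
exists N.+1 => // -[//|n] /= Nn.
have := hN n.+1 (leqW Nn) => /=.
set S := \sum_(i < n.+1) _ => hS; set T := \sum_(i < n.+1) _.
have -> : T = k * (S + b).
  pose F i j := c i j * (v.1 - a.1) ^+ i * (v.2 - a.2) ^+ j.
  rewrite /T /S -(double_sum_delta F) mulr_sumr; apply: eq_bigr => i _.
  rewrite mulr_sumr; apply: eq_bigr => j _; rewrite /F.
  have [/andP[/eqP -> /eqP ->]|_] := boolP ((i == 0 :> nat) && (j == 0 :> nat)).
    by rewrite !expr0 !mulr1 mulr1n.
  by rewrite mulr0n !addr0 !mulrA.
have -> : k * (S + b) - k * (f v + b) = k * (S - f v) by ring.
rewrite normcM; move: hS; rewrite ltr_pdivlMr ?ltr_wpDl ?normc_ge0// => hS.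
by apply: le_lt_trans hS; have := normc_ge0 (S - f v); nra.
Qed.

End PowerSeries.

(** * Bernstein exponent of a function comparable to a monomial *)

Section BernsteinExponent.
Variable R : realType.
Local Notation C := ((R[i])^o).

Lemma diskE (z0 z : C) (r : R) : disk z0 r z = (normc (z - z0) < r) :> Prop.
Proof. by []. Qed.

Lemma bernstein_cst (c : C) (z0 : C) (r mu : R) : 0 < r -> 0 < mu ->
  bernstein (fun=> c) mu z0 r = 0%E.
Proof.
move=> r0 mu0; rewrite /bernstein; case: asboolP => // nc.
have c0 : c != 0 by apply/eqP => c0; apply: nc.
have H s : 0 < s -> log_sup (fun=> c) z0 s = (ln (normc c))%:E.
  move=> s0; rewrite /log_sup -lne_EFin ?normc_gt0//.
  apply/eqP; rewrite eq_le; apply/andP; split.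
    by apply: ge_ereal_sup => _ [z _ <-].
  by apply: ereal_sup_ubound; exists z0 => //; rewrite diskE subrr normc0.
by rewrite !H ?mulr_gt0// subee.
Qed.

Lemma far_point (z0 : C) (r : R) : 0 < r ->
  exists2 w : C, disk z0 (1 / 4 * r) w & normc z0 + r / 8 <= normc w.
Proof.
move=> r0; have r80 : 0 < r / 8 by rewrite divr_gt0.
have [->|z00] := eqVneq z0 0.
  by exists (r / 8)%:C%C; rewrite ?diskE ?subr0 normc_real gtr0_norm// ?normc0; lra.
have n0 : 0 < normc z0 by rewrite normc_gt0.
pose t := r / 8 / normc z0; have t0 : 0 < t by rewrite !divr_gt0.
have tz : t * normc z0 = r / 8 by rewrite /t divfK// gt_eqF.
exists (z0 + t%:C%C * z0).
  rewrite diskE addrAC subrr add0r normcM normc_real gtr0_norm// tz; lra.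
have -> : z0 + t%:C%C * z0 = (1 + t)%:C%C * z0 by rewrite rmorphD rmorph1 mulrDl mul1r.
rewrite normcM normc_real gtr0_norm ?addr_gt0// mulrDl mul1r tz.
exact: lexx.
Qed.

(** The supremum over the large disk is at most 3 al (|z0| + r)^k; the value at a
far point of the small disk is at least al (|z0| + r / 8)^k; and
|z0| + r <= 8 (|z0| + r / 8). *)
Lemma bernstein_monomial_like (h : C -> C) (k : nat) (al : R) (z0 : C) (r : R) :
  0 < al -> 0 < r -> disk z0 r `<=` disk 0 1 ->
  (forall z, disk 0 1 z ->
     al * normc z ^+ k <= normc (h z) /\ normc (h z) <= 3 * al * normc z ^+ k) ->
  (bernstein h (1 / 4) z0 r <= (ln 3 + k%:R * ln 8)%:E)%E.
Proof.
move=> al0 r0 sub hh.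
have ln8 : 0 <= ln (8 : R) by rewrite ln_ge0//; lra.
have ln3 : 0 <= ln (3 : R) by rewrite ln_ge0//; lra.
rewrite /bernstein; case: asboolP => [_|_].
  by rewrite lee_fin addr_ge0// mulr_ge0.
have sub4 w : disk z0 (1 / 4 * r) w -> disk z0 r w.
  by rewrite !diskE; move/lt_trans; apply; lra.
pose X := 3 * al * (normc z0 + r) ^+ k.
pose Y := al * (normc z0 + r / 8) ^+ k.
have zr : 0 < normc z0 + r by rewrite ltr_wpDl ?normc_ge0.
have zr8 : 0 < normc z0 + r / 8 by rewrite ltr_wpDl ?normc_ge0// divr_gt0.
have X0 : 0 < X by rewrite !mulr_gt0 ?exprn_gt0.
have Y0 : 0 < Y by rewrite mulr_gt0 ?exprn_gt0.
have hX : (log_sup h z0 r <= (ln X)%:E)%E.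
  apply: ge_ereal_sup => _ [z zD <-]; rewrite -lne_EFin//.
  rewrite lee_lne ?in_itv /= ?lee_fin ?normc_ge0 ?leey ?andbT ?(ltW X0)//.
  apply: le_trans (hh z (sub _ zD)).2 _.
  rewrite ler_wpM2l ?mulr_ge0 ?(ltW al0)// lerXn2r ?nnegrE ?normc_ge0 ?(ltW zr)//.
  rewrite -lerBlDl; apply: le_trans (ltW zD); exact: normc_subr.
have hY : ((ln Y)%:E <= log_sup h z0 (1 / 4 * r))%E.
  have [w wD wz] := far_point z0 r0.
  apply: (@le_trans _ _ (lne (normc (h w))%:E)); last first.
    by apply: ereal_sup_ubound; exists w.
  rewrite -lne_EFin// lee_lne ?in_itv /= ?lee_fin ?normc_ge0 ?leey ?andbT ?(ltW Y0)//.
  apply: le_trans (hh w (sub _ (sub4 _ wD))).1.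
  by rewrite ler_wpM2l ?(ltW al0)// lerXn2r ?nnegrE ?normc_ge0 ?(ltW zr8).
apply: le_trans (leeB hX hY) _.
rewrite -EFinB lee_fin lerBlDr [_ * ln 8]mulr_natl -lnXn; last by lra.
have -> : ln 3 + ln (8 ^+ k) + ln Y = ln (3 * 8 ^+ k * Y).
  have p8 : 0 < (8 : R) ^+ k by rewrite exprn_gt0.
  have lnMr (u v : R) : 0 < u -> 0 < v -> ln (u * v) = ln u + ln v.
    by move=> u0 v0; rewrite lnM ?posrE.
  have q8 : 0 < 3 * (8 : R) ^+ k by rewrite mulr_gt0.
  by rewrite (lnMr _ _ q8 Y0) (lnMr 3).
rewrite ler_ln ?posrE ?mulr_gt0 ?exprn_gt0//.
have -> : 3 * 8 ^+ k * Y = 3 * al * (8 * (normc z0 + r / 8)) ^+ k.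
  by rewrite /Y exprMn; ring.
rewrite ler_wpM2l ?mulr_ge0 ?(ltW al0)// lerXn2r ?nnegrE ?(ltW zr)//.
  by rewrite mulr_ge0// ltW.
by have := normc_ge0 z0; lra.
Qed.

End BernsteinExponent.

(** * Polynomials in two variables *)

Section BivariatePolynomials.
Variable R : realType.
Local Notation C := ((R[i])^o).
Implicit Types f : bipoly R.

(** The variable of index i becomes the inner one and that of index j the outer
one, so that either coordinate can be the one kept by elimination. *)
Definition to_poly2 (i j : 'I_2) f : {poly {poly R[i]}} :=
  \sum_(m <- mpoly.msupp f) (mpoly.mcoeff m f *: 'X^(m i))%:P * 'X^(m j).

Lemma coef_to_poly2 i j f b :
  (to_poly2 i j f)`_b =
  \sum_(m <- mpoly.msupp f) (mpoly.mcoeff m f *: 'X^(m i)) *+ (b == m j).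
Proof.
rewrite coef_sum; apply: eq_bigr => m _.
by rewrite coefCM coefXn mulr_natr.
Qed.

Lemma msupp_le f m (i : 'I_2) :
  m \in mpoly.msupp f -> (m i <= total_degree f)%N.
Proof.
move=> /mpoly.msize_mdeg_lt; rewrite /total_degree => h.
have : (m i <= mpoly.mdeg m)%N by rewrite mpoly.mdegE (bigD1 i)//= leq_addr.
by move=> /leq_ltn_trans /(_ h); case: (mpoly.msize f).
Qed.

Lemma size_to_poly2 i j f : (size (to_poly2 i j f) <= (total_degree f).+1)%N.
Proof.
apply/leq_sizeP => b hb; rewrite coef_to_poly2 big_seq big1// => m mf.
have [bm|//] := eqVneq b (m j).
by move: (msupp_le j mf); rewrite -bm leqNgt hb.
Qed.

Lemma xdegree_to_poly2 i j f : xdegree_le (to_poly2 i j f) (total_degree f).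
Proof.
move=> b; rewrite coef_to_poly2; apply/leq_sizeP => a ha.
rewrite coef_sum big_seq big1// => m mf; rewrite coefMn coefZ coefXn.
have [am|] := eqVneq a (m i); last by rewrite mulr0 mul0rn.
by move: (msupp_le i mf); rewrite -am leqNgt ha.
Qed.

Lemma to_poly2_neq0 (i j : 'I_2) f : i != j -> f <> 0 -> to_poly2 i j f != 0.
Proof.
move=> ij f0.
have [m mf] : exists m, m \in mpoly.msupp f.
  case E : (mpoly.msupp f) => [|m s]; last by exists m; rewrite mem_head.
  by case: f0; apply/eqP; rewrite -mpoly.msupp_eq0 E.
apply/eqP => P0; move: (mf); rewrite mpoly.mcoeff_msupp => /eqP; apply.
have : ((to_poly2 i j f)`_(m j))`_(m i) = 0 by rewrite P0 !coef0.
rewrite coef_to_poly2 coef_sum (bigD1_seq m)//= ?mpoly.msupp_uniq//.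
rewrite eqxx mulr1n coefZ coefXn eqxx mulr1 big1 ?addr0// => m' m'm.
have [mj|_] := eqVneq (m j) (m' j); last by rewrite mulr0n coef0.
rewrite mulr1n coefZ coefXn; have [mi|_] := eqVneq (m i) (m' i); last by rewrite mulr0.
case/eqP: m'm; apply/mpoly.mnmP => l.
have [->//|li] := eqVneq l i; have [->//|lj] := eqVneq l j.
exfalso; clear -ij li lj; move: ij li lj.
by case: i => [[|[|//]] ?]; case: j => [[|[|//]] ?]; case: l => [[|[|//]] ?].
Qed.

Lemma pevalE f (v : C * C) : peval f v =
  \sum_(m <- mpoly.msupp f) mpoly.mcoeff m f * (v.1 ^+ m ord0 * v.2 ^+ m ord_max).
Proof.
rewrite /peval mpoly.mevalE; apply: eq_bigr => m _; congr (_ * _).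
by rewrite big_ord_recl big_ord1 /=; congr (_ * _ ^+ m _); exact: val_inj.
Qed.

Lemma ev2_to_poly2 i j f (x y : R[i] -> R[i]) w : ev2 (to_poly2 i j f) x y w =
  \sum_(m <- mpoly.msupp f) mpoly.mcoeff m f * (x w ^+ m i * y w ^+ m j).
Proof.
rewrite /ev2 /to_poly2 !horner_sum; apply: eq_bigr => m _.
by rewrite !hornerE.
Qed.

Lemma ev2_peval f (x y : R[i] -> R[i]) w :
  ev2 (to_poly2 ord0 ord_max f) x y w = peval f (x w, y w).
Proof. by rewrite ev2_to_poly2 pevalE. Qed.

Lemma ev2_peval_swap f (x y : R[i] -> R[i]) w :
  ev2 (to_poly2 ord_max ord0 f) y x w = peval f (x w, y w).
Proof.
by rewrite ev2_to_poly2 pevalE; apply: eq_bigr => m _; rewrite [y w ^+ _ * _]mulrC.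
Qed.

Lemma taylor_bigO1 (h : R[i] -> R[i]) : taylor h -> bigO 1 (fun w => h w - h 0).
Proof.
move=> th; have tg : taylor (fun w => h w - h 0) by exact: taylorD th (taylor_cst _).
apply: contrapT => /(taylor_leading tg)[k [a [k0 a0 /(leading_below a0)]]].
move: k0; rewrite ltnS leqn0 => /eqP -> [c c0 /near_normcP[d d0 /(_ 0)]].
by rewrite !subrr !normc0 expr0 mulr1 => /(_ d0); rewrite leNgt c0.
Qed.

(** Bezout's bound, along a parametrization, on the contact of the curve f2 = 0 with
f1 = 0; the alternative is that f1 vanishes on the branch. *)
Definition contact_bound (f1 f2 : bipoly R) (K : nat) :=
  forall x y : R[i] -> R[i], taylor x -> taylor y ->
  bounded_below 1 (fun w => x w - x 0) \/ bounded_below 1 (fun w => y w - y 0) ->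
  (\forall w \near (0 : C), peval f2 (x w, y w) = 0) ->
  (\forall w \near (0 : C), peval f1 (x w, y w) = 0) \/
  exists k a, [/\ (k <= K * total_degree f1)%N, a != 0 &
    leading k a (fun w => peval f1 (x w, y w))].

(** Eliminate y or x according to which coordinate is unramified. *)
Lemma exists_contact_bound (f2 : bipoly R) : f2 <> 0 ->
  exists K : nat, forall f1, contact_bound f1 f2 K.
Proof.
move=> f20.
have [K1 H1] := order_bound (@to_poly2_neq0 ord0 ord_max f2 isT f20).
have [K2 H2] := order_bound (@to_poly2_neq0 ord_max ord0 f2 isT f20).
exists (K1 + K2)%N => f1 x y tx ty [hx|hy] Z2.
- have [||[k]] := H1 _ _ _ _ _ tx ty (taylor_bigO1 tx) hx _ (size_to_poly2 ord0 ord_max f1)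
    (@xdegree_to_poly2 ord0 ord_max f1).
  + by move: Z2; apply: filterS => w; rewrite ev2_peval.
  + by move=> h; left; move: h; apply: filterS => w; rewrite ev2_peval.
  + move=> [a [kK a0 ka]]; right; exists k, a; split=> //.
      by apply: leq_trans kK _; rewrite leq_mul2r leq_addr orbT.
    by apply: bigO_eq ka => w; rewrite ev2_peval.
- have [||[k]] := H2 _ _ _ _ _ ty tx (taylor_bigO1 ty) hy _ (size_to_poly2 ord_max ord0 f1)
    (@xdegree_to_poly2 ord_max ord0 f1).
  + by move: Z2; apply: filterS => w; rewrite ev2_peval_swap.
  + by move=> h; left; move: h; apply: filterS => w; rewrite ev2_peval_swap.
  + move=> [a [kK a0 ka]]; right; exists k, a; split=> //.
      by apply: leq_trans kK _; rewrite leq_mul2r leq_addl orbT.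
    by apply: bigO_eq ka => w; rewrite ev2_peval_swap.
Qed.

Lemma peval_degree0 f : total_degree f = 0%N -> exists c : C, peval f = (fun=> c).
Proof.
move=> f0.
have /mpoly.msize1_polyC fE : (mpoly.msize f <= 1)%N.
  by move: f0; rewrite /total_degree; case: (mpoly.msize f) => [|[|]].
by rewrite fE; eexists; apply/funext => v; rewrite /peval mpoly.mevalC.
Qed.
End BivariatePolynomials.

(** * Charts of the regular locus *)

Section Parametrization.
Variable R : realType.
Local Notation C := ((R[i])^o).
Local Notation C2 := (C * C)%type.

Lemma analytic2_taylor (V : set C2) (f : C2 -> C) (b y : C) :
  analytic2 V f -> V (b, y) -> taylor (fun w => f (b + w, y)).
Proof.
move=> hf Vb; have [c hc] := analytic2_slice hf Vb; exact: series_taylor hc.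
Qed.

Lemma taylor_bigO2_or_below (h : R[i] -> R[i]) : taylor h ->
  bigO 2 (fun w => h w - h 0) \/ bounded_below 1 (fun w => h w - h 0).
Proof.
move=> th; have [|nO] := EM (bigO 2 (fun w => h w - h 0)); [by left|right].
have tg : taylor (fun w => h w - h 0) by exact: taylorD th (taylor_cst _).
have [k [a [k2 a0 /(leading_below a0)hk]]] := taylor_leading tg nO.
case: k k2 hk => [|[|//]] _ hk //.
by case: (bounded_below_bigO hk); exact: taylor_bigO1.
Qed.

Lemma bounded_below_id : bounded_below 1 (fun w : R[i] => w).
Proof.
by exists 1 => //; apply: near_normcW => w; rewrite mul1r expr1.
Qed.

(** If both coordinates were stationary at 0, their increments would be O(w^2),
against the Lipschitz bound |w| <= L |v - p| given by an inverse coordinate. *)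
Lemma unramified (x y : R[i] -> R[i]) (L : R) : 0 < L -> taylor x -> taylor y ->
  (\forall w \near (0 : C),
     normc w <= L * (normc (x w - x 0) + normc (y w - y 0))) ->
  bounded_below 1 (fun w => x w - x 0) \/ bounded_below 1 (fun w => y w - y 0).
Proof.
move=> L0 tx ty hL.
have [[K hK]|] := taylor_bigO2_or_below tx; last by left.
have [[M hM]|] := taylor_bigO2_or_below ty; last by right.
exfalso; apply: (bounded_below_bigO bounded_below_id).
exists (L * (K + M)); move: (near_and hL (near_and hK hM)).
apply: filterS => w [h1 [h2 h3]]; apply: le_trans h1 _.
by rewrite -mulrA ler_wpM2l ?(ltW L0)// mulrDl lerD.
Qed.

Lemma open_preimage_disk (U : set C2) (f : C2 -> C) (w0 : C) (e : R) :
  open U -> analytic2 U f -> open [set v | U v /\ normc (f v - w0) < e].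
Proof.
move=> oU hf; rewrite openE => v [Uv fv] /=; rewrite /interior.
have e0 : 0 < e - normc (f v - w0) by rewrite subr_gt0.
have hU : \forall v' \near v, U v' by exact: open_nbhs_nbhs.
apply: filterS2 hU (analytic2_near hf Uv e0) => v' Uv' fv'; split=> //.
have -> : f v' - w0 = (f v' - f v) + (f v - w0) by rewrite addrA subrK.
by apply: le_lt_trans (normc_add _ _) _; rewrite -ltrBrDr.
Qed.

(** Psi straightens Z near p and Phi is its inverse; the parametrization is
w |-> Phi (w0 + w, 0) with Psi p = (w0, 0).  It is unramified since the first
coordinate of Psi is Lipschitz, and that same coordinate inverts the charts. *)
Lemma reg_parametrization (Z : set C2) (p : C2) : reg Z p ->
  exists (x y : R[i] -> R[i]) (e0 : R),
  [/\ 0 < e0, taylor x /\ taylor y, (x 0, y 0) = p,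
    bounded_below 1 (fun w => x w - x 0) \/ bounded_below 1 (fun w => y w - y 0) &
    (forall w, normc w < e0 -> Z (x w, y w)) /\
    forall e : R, 0 < e -> e <= e0 ->
      chart (reg Z) (fun z => (x (e%:C%C * z), y (e%:C%C * z)) : C2)].
Proof.
move=> [Zp [U [V [Psi [oU [oV [Up [[hPsi [PsiU [Phi [hPhi PhiK]]]] PsiZ]]]]]]]].
have PhiU w : V w -> U (Phi w).
  by rewrite -PsiU => -[v Uv <-]; rewrite PhiK.
have PsiK w : V w -> Psi (Phi w) = w.
  by rewrite -PsiU => -[v Uv <-]; rewrite PhiK.
have PhiZ w : V w -> w.2 = 0 -> Z (Phi w).
  move=> Vw w2; have : (V `&` [set w | w.2 = 0]) w by split.
  by rewrite -PsiZ => -[v [Uv Zv] <-]; rewrite PhiK.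
have ZPsi v : U v -> Z v -> V (Psi v) /\ (Psi v).2 = 0.
  move=> Uv Zv; suff : (V `&` [set w | w.2 = 0]) (Psi v) by [].
  by rewrite -PsiZ; exists v.
have [VPp Pp2] := ZPsi p Up Zp.
pose w0 := (Psi p).1.
have Pp : Psi p = (w0, 0) by rewrite [LHS]surjective_pairing Pp2.
have [e0 e00 he0] : exists2 e0 : R, 0 < e0 & forall w, normc w < e0 -> V (w0 + w, 0).
  have /near_normc2P[d d0 hd] : \forall v \near Psi p, V v by exact: open_nbhs_nbhs.
  exists d => // w wd; apply: hd; rewrite Pp.
    by rewrite -[_ - _]/(w0 + w - w0) addrAC subrr add0r.
  by rewrite -[_ - _]/(0 - 0 : R[i]) subrr normc0.
have Vw0 : V (w0, 0) by rewrite -Pp.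
pose x w := (Phi (w0 + w, 0)).1; pose y w := (Phi (w0 + w, 0)).2.
have xyE w : (x w, y w) = Phi (w0 + w, 0) by rewrite -surjective_pairing.
have xy0 : (x 0, y 0) = p by rewrite xyE addr0 -Pp PhiK.
have tx : taylor x by exact: analytic2_taylor hPhi.1 Vw0.
have ty : taylor y by exact: analytic2_taylor hPhi.2 Vw0.
have regxy w : normc w < e0 -> reg Z (x w, y w).
  move=> we; rewrite xyE; split; first by apply: PhiZ; [exact: he0|].
  exists U, V, Psi; split; [exact: oU|split; [exact: oV|split]].
    by apply: PhiU; exact: he0.
  by split=> //; split=> //; split=> //; exists Phi.
exists x, y, e0; split=> //.
- have [L L0 [d d0 hL]] := analytic2_lipschitz hPsi.1 Up.
  apply: (unramified L0 tx ty).
  have [KX KX0 hKX] := bigO_pos (taylor_bigO1 tx).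
  have [KY KY0 hKY] := bigO_pos (taylor_bigO1 ty).
  have dK : 0 < d / (KX + KY) by rewrite divr_gt0// addr_gt0.
  move: (near_and (near_and hKX hKY) (near_and (near_normc0_lt e00) (near_normc0_lt dK))).
  apply: filterS => w [[h1 h2] [h3 h4]].
  move: h4; rewrite ltr_pdivlMr ?addr_gt0// => h4.
  have := hL (x w, y w) (normc (x w - x 0) + normc (y w - y 0)).
  rewrite -xy0 /=.
  have -> : (Psi (x w, y w)).1 - (Psi (x 0, y 0)).1 = w.
    by rewrite xy0 Pp xyE (PsiK _ (he0 _ h3)) /= addrAC subrr add0r.
  apply; rewrite ?lerDl ?lerDr ?normc_ge0//.
  by rewrite !expr1 in h1 h2; nra.
- split=> [w we|e e_gt0 ee0]; first by case: (regxy w we).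
have ne : normc (e%:C%C : R[i]) = e by rewrite normc_real gtr0_norm.
have eC0 : e%:C%C != 0 :> R[i] by rewrite -normc_gt0 ne.
have De z : disk 0 1 z -> normc (e%:C%C * z) < e0.
  rewrite diskE subr0 normcM ne => z1; apply: lt_le_trans ee0.
  by rewrite -[X in _ < X]mulr1 ltr_pM2l.
have DV z : disk 0 1 z -> V (w0 + e%:C%C * z, 0) by move=> /De; exact: he0.
pose g v : C := (e%:C%C : R[i])^-1 * ((Psi v).1 + - w0).
have gK z : disk 0 1 z -> g (x (e%:C%C * z), y (e%:C%C * z)) = z.
  by move=> zD; rewrite /g xyE (PsiK _ (DV _ zD)) /= addrAC subrr add0r mulKf.
split; first exact: analytic2_slice_analytic1 hPhi.1 DV.
split; first exact: analytic2_slice_analytic1 hPhi.2 DV.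
split.
  move=> z z' /set_mem zD /set_mem z'D E.
  by rewrite -(gK z zD) E gK.
split; last first.
  move=> z zD; exists U, g; split=> //; split.
    by rewrite xyE; apply: PhiU; exact: DV.
  split; first exact: analytic2_affine hPsi.1.
  by move=> z' z'D _; exact: gK.
exists [set v | U v /\ normc ((Psi v).1 - w0) < e]; split.
  exact: open_preimage_disk hPsi.1.
apply/seteqP; split.
  move=> _ [z zD <-]; split; first by apply: regxy; exact: De.
  rewrite /= xyE; split; first by apply: PhiU; exact: DV.
  rewrite (PsiK _ (DV _ zD)) /= addrAC subrr add0r normcM ne.
  by rewrite -[X in _ < X]mulr1 ltr_pM2l//; move: zD; rewrite diskE subr0.
move=> v [[Zv _] [Uv ve]]; have [VPv Pv2] := ZPsi v Uv Zv.
exists (g v).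
  rewrite diskE subr0 /g normcM normcV ne mulrC ltr_pdivrMr// mul1r.
  exact: ve.
have eg : e%:C%C * g v = (Psi v).1 - w0 by rewrite /g mulVKf.
rewrite eg xyE addrCA subrr addr0 -[RHS]PhiK//; congr Phi.
by rewrite [RHS]surjective_pairing Pv2.
Qed.

(** Where K |w| <= |a| / 2 the error term is at most half of the leading one. *)
Lemma leading_two_sided (h : R[i] -> R[i]) k (a : R[i]) :
  a != 0 -> leading k a h ->
  exists2 d : R, 0 < d & forall w, normc w < d ->
    normc a / 2 * normc w ^+ k <= normc (h w) /\
    normc (h w) <= 3 * (normc a / 2) * normc w ^+ k.
Proof.
rewrite -normc_gt0 => a0 /bigO_pos[K K0 hK].
have aK : 0 < normc a / (2 * K) by rewrite divr_gt0// mulr_gt0.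
have /near_normcP[d d0 hd] := near_and hK (near_normc0_lt aK).
exists d => // w wd; have [|] := hd w; first by rewrite subr0.
rewrite ltr_pdivlMr ?mulr_gt0// exprS => h1 h2.
have wk : 0 <= normc w ^+ k by rewrite exprn_ge0// normc_ge0.
have h3 : K * (normc w * normc w ^+ k) <= normc a / 2 * normc w ^+ k.
  by rewrite mulrA ler_wpM2r//; lra.
have := normc_subr (a * w ^+ k) (h w); have := normc_subr (h w) (a * w ^+ k).
rewrite [normc (a * _ - h w)]normc_dist normcM normc_pow.
split; lra.
Qed.

(** The radius e is taken so small that H vanishes on D(0, e), or is comparable
there to its leading monomial; the rescaling z |-> e z only changes the constant
in front of |z|^k. *)
Lemma chart_bernstein (f1 f2 : bipoly R) (K : nat) p :
  contact_bound f1 f2 K ->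
  reg (curve f2) p ->
  exists phi : C -> C2, [/\ chart (reg (curve f2)) phi, phi 0 = p &
    forall (z0 : C) (r : R), 0 < r -> disk z0 r `<=` disk 0 1 ->
      (bernstein (fun z => peval f1 (phi z)) (1 / 4) z0 r
         <= ((ln 3 + K%:R * ln 8) * (total_degree f1)%:R)%:E)%E].
Proof.
move=> HK hp.
have ln8 : 0 <= ln (8 : R) by rewrite ln_ge0//; lra.
have ln3 : 0 <= ln (3 : R) by rewrite ln_ge0//; lra.
have B0 : 0 <= (ln 3 + K%:R * ln 8) * (total_degree f1)%:R :> R.
  by rewrite mulr_ge0// addr_ge0// mulr_ge0.
have [x [y [e0 [e00 [tx ty] xy0 hxy [hZ hc]]]]] := reg_parametrization hp.
have phi0 (e : R) : (x (e%:C%C * 0), y (e%:C%C * 0)) = p by rewrite mulr0.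
(* the bound is then 0, and ln 3 cannot be absorbed *)
have [D0|D0] := posnP (total_degree f1).
  have [c cE] := peval_degree0 D0.
  exists (fun z => (x (e0%:C%C * z), y (e0%:C%C * z))); split=> //; first exact: hc.
  by move=> z0 r r0 _; rewrite cE bernstein_cst// lee_fin.
have Z2 : \forall w \near (0 : C), peval f2 (x w, y w) = 0.
  by move: (near_normc0_lt e00); apply: filterS => w /hZ[].
have small (d : R) : 0 < d -> exists e : R, [/\ 0 < e, e <= e0 &
    forall z, disk 0 1 z -> normc (e%:C%C * z) < d].
  move=> d0; exists (Num.min e0 d); rewrite lt_min e00 d0 ge_min lexx; split=> // z.
  rewrite diskE subr0 => z1; rewrite normcM normc_real gtr0_norm ?lt_min ?e00//.
  apply: (@lt_le_trans _ _ (Num.min e0 d)); last by rewrite ge_min lexx orbT.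
  by rewrite -[X in _ < X]mulr1 ltr_pM2l// lt_min e00.
have [/near_normcP[d d0 hd]|[k [a [kK a0 ka]]]] := HK x y tx ty hxy Z2.
  have [e [e1 e2 he]] := small d d0.
  exists (fun z => (x (e%:C%C * z), y (e%:C%C * z))); split=> //; first exact: hc.
  move=> z0 r r0 sub; rewrite /bernstein; case: asboolP => [_|[]].
    by rewrite lee_fin.
  by move=> z zD; apply: hd; rewrite subr0; apply: he; exact: sub.
have [d d0 hd] := leading_two_sided a0 ka.
have [e [e1 e2 he]] := small d d0.
exists (fun z => (x (e%:C%C * z), y (e%:C%C * z))); split=> //; first exact: hc.
move=> z0 r r0 sub.
apply: (@le_trans _ _ (ln 3 + k%:R * ln 8)%:E).
  apply: (@bernstein_monomial_like _ _ _ (normc a / 2 * e ^+ k)) => //.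
    by rewrite mulr_gt0 ?exprn_gt0// divr_gt0// normc_gt0.
  move=> z zD; have := hd _ (he z zD).
  by rewrite normcM normc_real (gtr0_norm e1) exprMn !mulrA.
rewrite lee_fin mulrDl lerD//; first by rewrite ler_peMr// ler1n.
by rewrite mulrAC ler_wpM2r// -natrM ler_nat.
Qed.

End Parametrization.

Theorem theoremB (R : realType) :
  exists C : bipoly R -> R,
  forall f1 f2 : bipoly R, f2 <> 0 ->
  exists A : set ((R[i])^o -> (R[i])^o * (R[i])^o),
    atlas (reg (curve f2)) A /\
    forall phi, A phi ->
    forall (z0 : (R[i])^o) (r : R), 0 < r ->
      disk z0 r `<=` disk 0 1 ->
      (bernstein (fun z => peval f1 (phi z)) (1 / 4) z0 r
         <= (C f2 * (total_degree f1)%:R)%:E)%E.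
Proof.
have /choice[K HK] (f2 : bipoly R) : exists K : nat, f2 <> 0 ->
    forall f1, contact_bound f1 f2 K.
  have [f20|f20] := EM (f2 = 0); first by exists 0%N.
  by have [K HK] := exists_contact_bound f20; exists K.
exists (fun f2 => ln 3 + (K f2)%:R * ln 8) => f1 f2 f20.
(* all the charts that satisfy the bound; the point is that they cover *)
exists [set phi | chart (reg (curve f2)) phi /\
  forall (z0 : (R[i])^o) (r : R), 0 < r -> disk z0 r `<=` disk 0 1 ->
    (bernstein (fun z => peval f1 (phi z)) (1 / 4) z0 r
       <= ((ln 3 + (K f2)%:R * ln 8) * (total_degree f1)%:R)%:E)%E].
split; last by move=> phi [].
split; first by move=> phi [].
apply/seteqP; split.
  move=> p hp; have [phi [hphi <- hB]] := chart_bernstein (HK f2 f20 f1) hp.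
  by exists phi => //; exists 0 => //; rewrite diskE subrr normc0.
move=> p [phi [[_ [_ [_ [[U [_ E]] _]]]] _] hp].
by move: hp; rewrite E => -[].
Qed.
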